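(* Let $\mu$ be a symmetric probability measure on $\mathbb{R}$ with $\int x^2\,d\mu(x)<+\infty$. Then $$W_2(\mu,\mathrm{b})\le D^*(\mu|\mathrm{b})\,\arccos\left(\exp\left\{-\frac{\Gamma(\mu|\mathrm{b})}{D^*(\mu|\mathrm{b})^2}\right\}\right).$$
   Context: $\mathrm{b}=\frac12\delta_{-1}+\frac12\delta_{1}$ is the Rademacher distribution. $W_2(\mu,\nu)=\inf_\pi\left(\iint|x-y|^2\,d\pi(x,y)\right)^{1/2}$, the infimum being over all couplings of $(\mu,\nu)$. For a symmetric probability measure $\mu$ on $\mathbb{R}$, $$\Gamma(\mu|\mathrm{b})=\frac12\int x^2\,d\mu(x)-\int\log|x|\,d\mu(x)-\frac12\in[0,+\infty],\qquad D^*(\mu|\mathrm{b})=\left(\int(x^2-1)^2\,d\mu(x)\right)^{1/2}\in[0,+\infty].$$ Degenerate cases of the right-hand side: if $D^*(\mu|\mathrm{b})=0$ (i.e. $\mu=\mathrm{b}$) it is read as $0$; if $D^*(\mu|\mathrm{b})=+\infty$ it is read as its limit value $\sqrt{2\Gamma(\mu|\mathrm{b})}$; and $\exp(-\infty)=0$. *)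

(* Defs.v *)
From HB Require Import structures.
From mathcomp Require Import all_boot all_order all_algebra.
From mathcomp Require Import all_classical all_reals all_analysis.
Import Order.TTheory GRing.Theory Num.Theory.
Import numFieldNormedType.Exports.

Set Implicit Arguments.
Unset Strict Implicit.
Unset Printing Implicit Defensive.

Local Open Scope classical_set_scope.
Local Open Scope ring_scope.
Local Open Scope ereal_scope.

Section rademacher.
Context {R : realType}.

Definition rademacher : set (measurableTypeR R) -> \bar R :=
  mscale (2^-1)%:nng%R
    (measure_add (dirac (- 1 : measurableTypeR R)%R)
                 (dirac (1 : measurableTypeR R)%R)).

HB.instance Definition _ := Measure.on rademacher.

Let rademacher_setT : rademacher setT = 1.
Proof.
rewrite /rademacher /mscale [X in _ * X](_ : _ = 1 + 1); last first.
  by rewrite [LHS]measure_addE; congr (_ + _); exact: diracT.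
by rewrite -EFinD -EFinM mulVf ?pnatr_eq0.
Qed.

HB.instance Definition _ :=
  @Measure_isProbability.Build _ _ R rademacher rademacher_setT.

End rademacher.

Section definitions.
Context {R : realType}.
Implicit Types mu nu : probability (measurableTypeR R) R.

Definition symmetric_measure mu : Prop :=
  forall A : set (measurableTypeR R), measurable A ->
    pushforward mu (fun x : measurableTypeR R => (- x)%R : measurableTypeR R) A
    = mu A.

Definition coupling mu nu
    (pi : probability (measurableTypeR R * measurableTypeR R)%type R) : Prop :=
  forall A : set (measurableTypeR R), measurable A ->
    pushforward pi fst A = mu A /\ pushforward pi snd A = nu A.

Definition W2 mu nu : \bar R :=
  ereal_inf [set sqrte (\int[pi]_z (`|z.1 - z.2| ^+ 2)%:E)
            | pi in coupling mu nu].

(* [lne 0 = -oo], unlike the real-valued [ln 0 = 0]: an atom of [mu] at the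
   origin gives [Gamma mu = +oo]. *)
Definition Gamma mu : \bar R :=
  (2^-1)%:E * \int[mu]_x (x ^+ 2)%:E - \int[mu]_x lne (`|x|%:E) - (2^-1)%:E.

Definition Dstar mu : \bar R := sqrte (\int[mu]_x ((x ^+ 2 - 1) ^+ 2)%:E).

(* The function [D * arccos (exp (- G / D ^ 2))] extended to [D = 0], where it is
   read as [0], and to [D = +oo], where it is read as its limit.  For
   [0 < D < +oo] and [0 <= G] the argument of [fine] lies in [0, 1], with
   [expeR -oo = 0]. *)
Definition arccos_bound (D G : \bar R) : \bar R :=
  if D == 0 then 0
  else if D == +oo then sqrte (2%:E * G)
  else D * (acos (fine (expeR (- (G / D ^+ 2)))))%:E.

End definitions.

(* Main.v *)
(* Write a = int (|x|-1)^2 dmu and D^2 = int (x^2-1)^2 dmu.  By symmetry, the law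
   of (eps |X|, eps), with eps an independent uniform sign, couples mu with the
   Rademacher law, so that W2^2 <= a <= D^2.  With t = sqrt a / D <= 1 and
   v = t^2/2, a pointwise bound on the logarithm involving only |x|-1 and x^2-1,
   optimized over a free parameter l (taken to be t^2), integrates to
   Gamma >= D^2 (v + 2 v^2).  Hence
     exp (- Gamma / D^2) <= exp (- (v + 2 v^2)) <= 1 - v <= cos t,
   and t <= arccos (exp (- Gamma / D^2)).  The case D = +oo only uses l = 0. *)
Require Import Defs.
From HB Require Import structures.
From mathcomp Require Import all_boot all_order all_algebra.
From mathcomp Require Import all_classical all_reals all_analysis measurable_realfun.
From mathcomp Require Import ring lra.

Set Implicit Arguments.
Unset Strict Implicit.
Unset Printing Implicit Defensive.

Import Order.TTheory GRing.Theory Num.Theory.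
Import numFieldNormedType.Exports.
Local Open Scope classical_set_scope.
Local Open Scope ring_scope.

(** * Elementary bounds on sin, cos, exp and arccos *)

Lemma sin_le_id {R : realType} (x : R) : 0 <= x -> sin x <= x.
Proof.
move=> x0; have sin_cont : {within `[0, x], continuous (@sin R)}.
  by apply: continuous_subspaceT => y; exact: continuous_sin.
have [c _] := MVT_segment x0 (fun y _ => is_derive_sin y) sin_cont.
rewrite sin0 !subr0 => ->; rewrite -[leRHS]mul1r.
by rewrite ler_wpM2r // cos_le1.
Qed.

(** Half-angle formula: cos (2u) = 1 - 2 sin^2 u, combined with sin u <= u. *)
Lemma cos_ge1Bsqr {R : realType} (t : R) :
  0 <= t <= 1 -> 1 - t ^+ 2 / 2 <= cos t.
Proof.
move=> t01; have [u -> u0] : exists2 u, t = u + u & 0 <= u <= 2^-1.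
  by exists (t / 2); lra.
have s0 : 0 <= sin u by apply: sin_ge0_pi; have := pi_ge2 R; lra.
have su : sin u ^+ 2 <= u ^+ 2 by rewrite ler_sqr ?nnegrE ?sin_le_id //; lra.
have -> : cos (u + u) = 1 - 2 * sin u ^+ 2.
  by rewrite cosD -!expr2 cos2sin2; ring.
lra.
Qed.

(** Since e^w >= 1 + w, it suffices that (1 - v)(1 + v + 2v^2) = 1 + v^2 (1 - 2v) is at least 1,
    which is where v <= 1/2 enters. *)
Lemma expRN_le1B {R : realType} (v : R) :
  0 <= v <= 2^-1 -> expR (- (v + 2 * v ^+ 2)) <= 1 - v.
Proof.
move=> v01; rewrite expRN.
have e := @expR_ge1Dx R (v + 2 * v ^+ 2).
rewrite -[leLHS]mul1r ler_pdivrMr ?expR_gt0 //.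
apply: (@le_trans _ _ ((1 - v) * (1 + (v + 2 * v ^+ 2)))); first by nra.
by rewrite ler_wpM2l //; lra.
Qed.

Lemma le_acos {R : realType} (t e : R) :
  0 <= t <= 1 -> 0 <= e <= cos t -> t <= acos e.
Proof.
move=> /andP[t0 t1] /andP[e0 ec].
have e1 : -1 <= e <= 1 by have := cos_le1 t; lra.
rewrite leNgt; apply/negP => lt_ae.
have := pi_ge2 R => p2.
have := acos_def e1 => -[ap ce].
have : cos t < cos (acos e) by rewrite ltr_cos // in_itv /=; lra.
by rewrite ce; lra.
Qed.

Local Open Scope ereal_scope.

(** * Integrals of extended-valued functions *)

Lemma measurable_lne_normr {R : realType} :
  measurable_fun [set: measurableTypeR R]
    ((fun x => lne (`|x|%:E)) : measurableTypeR R -> \bar R).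
Proof.
rewrite /lne; apply: measurable_fun_ifT => //.
- apply: measurable_fun_ler => //; exact: normr_measurable.
- apply/measurable_EFinP; apply: measurableT_comp; first exact: measurable_ln.
  exact: normr_measurable.
Qed.

Lemma measurable_le_integral d (T : measurableType d) (R : realType)
    (mu : {measure set T -> \bar R}) (f g : T -> \bar R) :
  measurable_fun setT f -> measurable_fun setT g -> (forall x, f x <= g x) ->
  \int[mu]_x f x <= \int[mu]_x g x.
Proof.
move=> mf mg fg; rewrite [leLHS]integralE [leRHS]integralE.
apply: leeB; apply: ge0_le_integral => //=.
- exact: measurable_funepos.
- exact: measurable_funepos.
- by move=> x _; apply: (@funepos_le _ _ setT) => //; rewrite inE.
- exact: measurable_funeneg.
- exact: measurable_funeneg.
- by move=> x _; apply: (@funeneg_le _ _ setT) => //; rewrite inE.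
Qed.

(** * The sign coupling and its transport cost *)

(** As {|x|, -|x|} = {x, -x}, the two preimages have the same union and intersection as [A] and its
    reflection; inclusion-exclusion and symmetry conclude. *)
Lemma symmetric_measure_normr {R : realType}
    (mu : probability (measurableTypeR R) R) (A : set (measurableTypeR R)) :
  symmetric_measure mu -> measurable A ->
  mu ((fun x : R => `|x|%R) @^-1` A) + mu ((fun x : R => - `|x|)%R @^-1` A)
  = mu A + mu A.
Proof.
move=> smu mA.
have mN : measurable (-%R @^-1` A : set (measurableTypeR R)).
  by rewrite -[X in measurable X]setTI; exact: oppr_measurable.
have mP : measurable ((fun x : R => `|x|%R) @^-1` A : set (measurableTypeR R)).
  by rewrite -[X in measurable X]setTI; exact: normr_measurable.
have mQ : measurable ((fun x : R => - `|x|)%R @^-1` A : set (measurableTypeR R)).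
  rewrite -[X in measurable X]setTI.
  by apply: measurable_funN => //; exact: normr_measurable.
rewrite -[X in _ = X + _]smu //.
have UI B C : measurable B -> measurable C -> mu B + mu C = mu (B `|` C) + mu (B `&` C).
  move=> mB mC; rewrite measureUfinl //; last by rewrite ltey_eq fin_num_measure.
  by rewrite subeK // fin_num_measure //; exact: measurableI.
rewrite UI // [RHS]UI //; congr (mu _ + mu _); apply/seteqP; split => x /=;
  case: (lerP 0 x) => x0; rewrite ?(ger0_norm x0) ?(ltr0_norm x0) ?opprK; tauto.
Qed.

(** The pair (eps |X|, eps) once the sign eps is fixed to [s]. *)
Definition spread {R : realType} (s : R) (x : measurableTypeR R) :
  measurableTypeR R * measurableTypeR R := ((s * `|x|)%R, s).

Lemma measurable_spread {R : realType} (s : R) : measurable_fun setT (spread s).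
Proof.
apply: measurable_fun_pair => //.
by apply: measurable_funM => //; exact: normr_measurable.
Qed.

HB.instance Definition _ (R : realType) (s : R) :=
  isMeasurableFun.Build _ _ _ _ (spread s) (measurable_spread s).

(** Written as a half-sum of two image laws, in the same shape as [rademacher], so that marginals
    and integrals split over the two signs. *)
Definition sign_coupling {R : realType} (mu : probability (measurableTypeR R) R) :
    set (measurableTypeR R * measurableTypeR R) -> \bar R :=
  mscale (2^-1)%:nng%R
    (measure_add (distribution mu (spread (-1)%R)) (distribution mu (spread 1%R))).

HB.instance Definition _ (R : realType) (mu : probability (measurableTypeR R) R) :=
  Measure.on (sign_coupling mu).

Lemma sign_couplingE {R : realType} (mu : probability (measurableTypeR R) R) A :
  sign_coupling mu A =
  (2^-1)%:E * (mu (spread (-1)%R @^-1` A) + mu (spread 1%R @^-1` A)).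
Proof. by rewrite /sign_coupling /mscale; congr (_ * _); exact: measure_addE. Qed.

Lemma sign_coupling_setT {R : realType} (mu : probability (measurableTypeR R) R) :
  sign_coupling mu setT = 1.
Proof.
rewrite sign_couplingE !preimage_setT !probability_setT.
by rewrite -EFinD -EFinM mulVf ?pnatr_eq0.
Qed.

HB.instance Definition _ (R : realType) (mu : probability (measurableTypeR R) R) :=
  @Measure_isProbability.Build _ _ R (sign_coupling mu) (sign_coupling_setT mu).

Lemma coupling_sign_coupling {R : realType} (mu : probability (measurableTypeR R) R) :
  symmetric_measure mu -> coupling mu rademacher (sign_coupling mu).
Proof.
move=> smu A mA; split; rewrite [LHS]sign_couplingE.
  have -> : spread (-1)%R @^-1` (fst @^-1` A) = (fun x => - `|x|)%R @^-1` A.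
    by apply/seteqP; split => x /=; rewrite mulN1r.
  have -> : spread 1%R @^-1` (fst @^-1` A) = (fun x => `|x|)%R @^-1` A.
    by apply/seteqP; split => x /=; rewrite mul1r.
  rewrite addeC symmetric_measure_normr // -(fineK (fin_num_measure mu A mA)).
  by rewrite -EFinD -EFinM; congr EFin; lra.
(* The second coordinate of [spread s] is constant, so its law is a Dirac mass. *)
have cstE s : mu (spread s @^-1` (snd @^-1` A)) = dirac s A.
  rewrite diracE; have [/set_mem As|As] := boolP (s \in A).
    rewrite (_ : _ @^-1` _ = setT) ?probability_setT //.
    by apply/seteqP; split.
  rewrite (_ : _ @^-1` _ = set0) ?measure0 //.
  by apply/seteqP; split => // x /= sA; move: As; rewrite notin_setE.
by rewrite !cstE /rademacher /mscale; congr (_ * _); rewrite [RHS]measure_addE.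
Qed.

Lemma W2_rademacher_le {R : realType} (mu : probability (measurableTypeR R) R) :
  symmetric_measure mu ->
  W2 mu rademacher <= sqrte (\int[mu]_x ((`|x| - 1) ^+ 2)%:E).
Proof.
move=> smu; apply: ereal_inf_lbound.
exists (sign_coupling mu); first exact: coupling_sign_coupling.
congr sqrte.
have mc : measurable_fun setT
    ((fun z => (`|z.1 - z.2| ^+ 2)%:E) : measurableTypeR R * measurableTypeR R -> \bar R).
  apply/measurable_EFinP; apply: measurable_funX; apply: measurableT_comp => //.
  by apply: measurable_funB.
have m1 : measurable_fun setT
    ((fun x => ((`|x| - 1) ^+ 2)%:E) : measurableTypeR R -> \bar R).
  by apply/measurable_EFinP; apply: measurable_funX; apply: measurable_funB.
have c0 (z : R * R) : 0 <= (`|z.1 - z.2| ^+ 2)%:E by rewrite lee_fin exprn_ge0.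
(* Both signs cost the same: s|x| - s = s(|x| - 1) with |s| = 1. *)
have costE (s : R) : (`|s| = 1)%R ->
    \int[distribution mu (spread s)]_z (`|z.1 - z.2| ^+ 2)%:E
    = \int[mu]_x ((`|x| - 1) ^+ 2)%:E.
  move=> s1; rewrite ge0_integral_distribution //; apply: eq_integral => x _ /=.
  by rewrite -[X in (_ - X)%R]mulr1 -mulrBr normrM s1 mul1r real_normK // num_real.
rewrite ge0_integral_mscale // ge0_integral_measure_add // !costE ?normrN1 ?normr1 //.
have I0 : 0 <= \int[mu]_x ((`|x| - 1) ^+ 2)%:E.
  by apply: integral_ge0 => x _; rewrite lee_fin sqr_ge0.
rewrite ge0_muleDr // -ge0_muleDl // -EFinD.
by rewrite [X in X%:E * _](_ : _ = 1%R) ?mul1e //=; lra.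
Qed.

(** * Lower bound on Gamma from a pointwise bound on the logarithm *)

(* With y = sqrt x and b = (x + 1)^2 this follows from ln y <= y - 1,
   l - l^2 b / 2 <= 1 / (2 b) and (x - 1)^2 / (2 b) <= (y - 1)^2. *)
Lemma ln_le_quartic {R : realType} (l x : R) : (0 < x)%R ->
 (ln x <= x ^+ 2 / 2 - 2^-1 - (x - 1) ^+ 2 / 2
    - (l * (x - 1) ^+ 2 - l ^+ 2 / 2 * (x ^+ 2 - 1) ^+ 2))%R.
Proof.
move=> x0; pose y := Num.sqrt x.
have y0 : (0 < y)%R by rewrite sqrtr_gt0.
have xy : x = (y ^+ 2)%R by rewrite sqr_sqrtr // ltW.
have lny : (ln y <= y - 1)%R.
  by rewrite -[in leLHS](subrKC 1 y); apply: le_ln1Dx; lra.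
have -> : ln x = (ln y *+ 2)%R by rewrite xy lnXn.
pose b := ((x + 1) ^+ 2)%R.
have b0 : (0 < b)%R by rewrite exprn_gt0 // addr_gt0.
have key : (0 <= (y - 1) ^+ 2 - (l - l ^+ 2 / 2 * b) * (x - 1) ^+ 2)%R.
  rewrite -(pmulr_rge0 _ b0).
  have -> : (b * ((y - 1) ^+ 2 - (l - l ^+ 2 / 2 * b) * (x - 1) ^+ 2)
    = (1 - l * b) ^+ 2 * (x - 1) ^+ 2 / 2
      + (y - 1) ^+ 2 * (b - (y + 1) ^+ 2 / 2))%R by rewrite xy; field.
  apply: addr_ge0; first by rewrite divr_ge0 // mulr_ge0 // sqr_ge0.
  (* Here b = (y^2 + 1)^2 >= y^2 + 1 >= (y + 1)^2 / 2. *)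
  by rewrite mulr_ge0 ?sqr_ge0 // /b xy; nra.
have -> : (x ^+ 2 / 2 - 2^-1 - (x - 1) ^+ 2 / 2
    - (l * (x - 1) ^+ 2 - l ^+ 2 / 2 * (x ^+ 2 - 1) ^+ 2)
   = y ^+ 2 - 1 - (l - l ^+ 2 / 2 * b) * (x - 1) ^+ 2)%R by rewrite /b xy; field.
by rewrite mulr2n; nra.
Qed.

Lemma ge0_integrable_EFin d (T : measurableType d) (R : realType)
    (mu : {measure set T -> \bar R}) (f : T -> R) :
  measurable_fun setT f -> (forall x, (0 <= f x)%R) ->
  \int[mu]_x (f x)%:E < +oo -> mu.-integrable setT (EFin \o f).
Proof.
move=> mf f0 fi; apply/integrableP; split; first exact/measurable_EFinP.
by under eq_integral => x _ do rewrite /= ger0_norm ?f0 //.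
Qed.

(** Integrates [ln_le_quartic] at |x|; the second moment [m] cancels. Keeping [l] inside the square
    that defines [q] lets l = 0 be used even when D* is infinite. *)
Lemma Gamma_ge {R : realType} (mu : probability (measurableTypeR R) R)
    (l m a q : R) :
  \int[mu]_x (x ^+ 2)%:E = m%:E ->
  \int[mu]_x ((`|x| - 1) ^+ 2)%:E = a%:E ->
  \int[mu]_x ((l * (x ^+ 2 - 1)) ^+ 2)%:E = q%:E ->
  (a / 2 + l * a - q / 2)%:E <= Gamma mu.
Proof.
move=> hm ha hq.
(* Integrability and value are carried together, so that the integral of [psi] can be read off its
   syntactic shape. *)
pose has (f : measurableTypeR R -> R) (r : R) :=
  mu.-integrable setT (EFin \o f) /\ \int[mu]_x (f x)%:E = r%:E.
have has_sq (f : measurableTypeR R -> R) r : measurable_fun setT f ->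
    \int[mu]_x (f x ^+ 2)%:E = r%:E ->
    has (fun x => (f x ^+ 2)%R) r.
  move=> mf fr; split=> //; apply: ge0_integrable_EFin => [|x|].
  - exact: measurable_funX.
  - exact: sqr_ge0.
  - by rewrite fr ltry.
have has_axpy (c : R) f r g s : has f r -> has g s ->
    has (fun x => (c * f x + g x)%R) (c * r + s)%R.
  move=> [If fr] [Ig gs].
  have Icf : mu.-integrable setT (EFin \o (fun x => (c * f x)%R)).
    exact: (integrableZl measurableT c If).
  split; first exact: (integrableD measurableT Icf Ig).
  under eq_integral do rewrite EFinD.
  rewrite integralD_EFin // gs EFinD; congr (_ + _).
  by rewrite EFinM -fr -integralZl.
have has_cst c : has (fun=> c) c.
  split; first exact: finite_measure_integrable_cst.
  by rewrite integral_cst // [X in _ * X]probability_setT mule1.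
have {}hm := has_sq id _ (@measurable_id _ _ _) hm.
have {}ha := has_sq (fun x => `|x| - 1)%R _ ltac:(by apply: measurable_funB) ha.
have {}hq : has (fun x => ((l * (x ^+ 2 - 1)) ^+ 2)%R) q.
  apply: has_sq hq; apply: measurable_funM => //.
  by apply: measurable_funB => //; exact: measurable_funX.
(* The right-hand side of [ln_le_quartic] at |x|, nested so that [has_axpy] applies three times. *)
pose psi (x : measurableTypeR R) :=
  (2^-1 * x ^+ 2 + ((- (2^-1) - l) * (`|x| - 1) ^+ 2
    + (2^-1 * (l * (x ^+ 2 - 1)) ^+ 2 + (- (2^-1)))))%R.
have [Ipsi psiE] : has psi (2^-1 * m + ((- (2^-1) - l) * a + (2^-1 * q + (- (2^-1)))))%R.
  by do 3 apply: (has_axpy) => //.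
have lne_le (x : measurableTypeR R) : lne `|x|%:E <= (psi x)%:E.
  (* At the origin [lne] is -oo, so the bound is trivial there. *)
  have [->|x0] := eqVneq x 0%R; first by rewrite normr0 le0_lneNy // leNye.
  rewrite lne_EFin ?normr_gt0 // lee_fin.
  have := @ln_le_quartic R l `|x|%R; rewrite normr_gt0 => /(_ x0) /le_trans; apply.
  by rewrite real_normK ?num_real // /psi; lra.
have int_le : \int[mu]_x lne `|x|%:E <= \int[mu]_x (psi x)%:E.
  apply: measurable_le_integral => //; first exact: measurable_lne_normr.
  by case/integrableP : Ipsi.
rewrite /Gamma hm.2.
apply: (@le_trans _ _ ((2^-1)%:E * m%:E - \int[mu]_x (psi x)%:E - (2^-1)%:E)).
  by rewrite psiE -EFinM -!EFinB lee_fin; lra.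
by apply: leeB => //; apply: leeB.
Qed.

(** * Case analysis on D* and the choice of [l] *)

Theorem theorem3p12 (R : realType) (mu : probability (measurableTypeR R) R)
  (mu_sym : symmetric_measure mu)
  (mu_mom2 : \int[mu]_x (x ^+ 2)%:E < +oo) :
  W2 mu rademacher <= arccos_bound (Dstar mu) (Gamma mu).
Proof.
apply: (le_trans (W2_rademacher_le mu_sym)).
have mabs : measurable_fun setT (fun x : measurableTypeR R => `|x| - 1)%R.
  exact: measurable_funB.
have msq : measurable_fun setT (fun x : measurableTypeR R => x ^+ 2 - 1)%R.
  by apply: measurable_funB => //; exact: measurable_funX.
have A0 : 0 <= \int[mu]_x ((`|x| - 1) ^+ 2)%:E.
  by apply: integral_ge0 => x _; rewrite lee_fin sqr_ge0.
have Q0 : 0 <= \int[mu]_x ((x ^+ 2 - 1) ^+ 2)%:E.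
  by apply: integral_ge0 => x _; rewrite lee_fin sqr_ge0.
have AQ : \int[mu]_x ((`|x| - 1) ^+ 2)%:E <= \int[mu]_x ((x ^+ 2 - 1) ^+ 2)%:E.
  apply: ge0_le_integral => //=.
  - by move=> x _; rewrite lee_fin sqr_ge0.
  - by apply/measurable_EFinP; apply: measurable_funX.
  - by apply/measurable_EFinP; apply: measurable_funX.
  - move=> x _; rewrite lee_fin -(real_normK (num_real x)).
    have -> : ((`|x| ^+ 2 - 1) ^+ 2 =
      (`|x| - 1) ^+ 2 + (`|x| - 1) ^+ 2 * (`|x| * (`|x| + 2)))%R by ring.
    by rewrite lerDl mulr_ge0 ?sqr_ge0 // mulr_ge0 // addr_ge0.
have [m hm] : exists m, \int[mu]_x (x ^+ 2)%:E = m%:E.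
  exists (fine (\int[mu]_x (x ^+ 2)%:E)); rewrite fineK // ge0_fin_numE //.
  by apply: integral_ge0 => x _; rewrite lee_fin sqr_ge0.
have [a ha] : exists a, \int[mu]_x ((`|x| - 1) ^+ 2)%:E = a%:E.
  exists (fine (\int[mu]_x ((`|x| - 1) ^+ 2)%:E)); rewrite fineK // ge0_fin_numE //.
  (* Finiteness of [a] comes from (|x| - 1)^2 <= x^2 + 1. *)
  apply: (@le_lt_trans _ _ (\int[mu]_x ((x ^+ 2)%:E + 1))).
    apply: ge0_le_integral => //=.
    - by move=> x _; rewrite lee_fin sqr_ge0.
    - by apply/measurable_EFinP; apply: measurable_funX.
    - apply: emeasurable_funD => //.
      by apply/measurable_EFinP; exact: measurable_funX.
    - move=> x _; rewrite -EFinD lee_fin -(real_normK (num_real x)).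
      by have := normr_ge0 x; nra.
  rewrite ge0_integralD //=.
  - by rewrite hm integral_cst // [X in _ * X]probability_setT mule1 -EFinD ltry.
  - by move=> x _; rewrite lee_fin sqr_ge0.
  - by apply/measurable_EFinP; exact: measurable_funX.
have a0 : (0 <= a)%R by rewrite -lee_fin -ha.
rewrite /arccos_bound; case: ifPn => [/eqP D0|Dn0].
  by rewrite -D0 lee_sqrt.
case: ifPn => [_|Dny].
  (* With l = 0 the quartic integrand vanishes identically, leaving Gamma >= a / 2. *)
  have := @Gamma_ge R mu 0 m a 0 hm ha.
  rewrite !mul0r addr0 subr0 => G0.
  have {}G0 : (a / 2)%:E <= Gamma mu.
    by apply: G0; apply: integral0_eq => x _; rewrite mul0r expr0n.
  have {}G0 : a%:E <= 2%:E * Gamma mu.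
    rewrite (_ : a = 2 * (a / 2))%R; last by lra.
    by rewrite EFinM lee_pmul2l.
  by rewrite ha lee_sqrt //; apply: le_trans G0.
have [q hq] : exists q, \int[mu]_x ((x ^+ 2 - 1) ^+ 2)%:E = q%:E.
  exists (fine (\int[mu]_x ((x ^+ 2 - 1) ^+ 2)%:E)).
  rewrite fineK // -sqrte_fin_num // fin_numE Dny andbT.
  by rewrite gt_eqF // (lt_le_trans _ (sqrte_ge0 _)) // ltNyr.
move: Dn0 AQ Q0; rewrite /Dstar hq ha !lee_fin /= eqe => d0 aq q0.
set d := Num.sqrt q in d0 *.
have {}d0 : (0 < d)%R by rewrite lt_neqAle eq_sym d0 sqrtr_ge0.
have qd : q = (d ^+ 2)%R by rewrite sqr_sqrtr.
pose t := (Num.sqrt a / d)%R.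
have t0 : (0 <= t)%R by rewrite divr_ge0 ?sqrtr_ge0 // ltW.
have t1 : (t <= 1)%R by rewrite ler_pdivrMr // mul1r ler_wsqrtr.
have wt : Num.sqrt a = (d * t)%R by rewrite mulrC divfK // gt_eqF.
have at_ : a = (d ^+ 2 * t ^+ 2)%R by rewrite -exprMn -wt sqr_sqrtr.
(* The value l = a / q = t^2 maximizes l a - l^2 q / 2; the total is then d^2 (t^2 / 2 + t^4 /
   2). *)
have G_ge : (d ^+ 2 * (t ^+ 2 / 2 + 2 * (t ^+ 2 / 2) ^+ 2))%:E <= Gamma mu.
  have lq : \int[mu]_x ((t ^+ 2 * (x ^+ 2 - 1)) ^+ 2)%:E = ((t ^+ 2) ^+ 2 * q)%:E.
    rewrite EFinM -hq -ge0_integralZl_EFin ?sqr_ge0 //.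
    - by apply: eq_integral => x _; rewrite exprMn EFinM.
    - by move=> x _; rewrite lee_fin sqr_ge0.
    - by apply/measurable_EFinP; exact: measurable_funX.
  apply: le_trans (Gamma_ge hm ha lq).
  by rewrite lee_fin at_ qd; lra.
rewrite wt ler_pM2l //; apply: le_acos; first by rewrite t0.
have ct := cos_ge1Bsqr (introT andP (conj t0 t1)).
rewrite fine_ge0 ?expeR_ge0 //=.
apply: le_trans ct.
have v01 : (0 <= t ^+ 2 / 2 <= 2^-1)%R by nra.
have d2 : (0 < d * d)%R by rewrite mulr_gt0.
rewrite -EFinM inver gt_eqF //.
case: (Gamma mu) G_ge => [g||//].
- rewrite lee_fin => G_ge.
  rewrite /=; apply: le_trans (expRN_le1B v01); rewrite ler_expR lerN2.
  by rewrite ler_pdivlMr // -expr2 mulrC.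
(* If Gamma = +oo the exponential is 0, and only 0 <= 1 - t^2 / 2 remains. *)
- move=> _; rewrite gt0_mulye ?lte_fin ?invr_gt0 //=.
  by lra.
Qed.
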